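(* Let $\Lambda$ be a cocompact lattice in the Lie group $\mathrm{SL}_2(\mathbf{C})$ and let $M=\mathrm{SL}_2(\mathbf{C})/\Lambda$, a compact complex manifold of dimension $3$. There is a non-abelian free group $\Gamma\subset\mathrm{SL}_2(\mathbf{C})$ acting freely on $M$ by left translation. Moreover, there is a dense $G_\delta$ subset $\mathcal{F}$ of $\mathrm{SL}_2(\mathbf{C})\times\mathrm{SL}_2(\mathbf{C})$ such that any pair $(\gamma_1,\gamma_2)\in\mathcal{F}$ generates a free subgroup of rank $2$ in $\mathrm{SL}_2(\mathbf{C})$ acting freely on $M$ (by left translation).
   Context: An element $\gamma\in\mathrm{SL}_2(\mathbf{C})$ acts on $M$ by left translation: $g\Lambda\mapsto \gamma g\Lambda$. An action of a group on a set is free if every point has trivial stabilizer. *)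

(* Defs.v *)
From HB Require Import structures.
From mathcomp Require Import all_boot all_order all_algebra.
From mathcomp Require Import generic_quotient.
From mathcomp Require Import all_classical all_reals topology normedtype.
From mathcomp Require Import borel_hierarchy complex.

Set Implicit Arguments.
Unset Strict Implicit.
Unset Printing Implicit Defensive.

Import GRing.Theory numFieldNormedType.Exports.

Local Open Scope classical_set_scope.
Local Open Scope quotient_scope.
Local Open Scope group_scope.

Section Groups.
Variable G : groupType.
Implicit Types (H X : set G) (w : seq (G * bool)).

Definition subgroup H : Prop := group_closed (mem H).

Definition generated X : set G := smallest subgroup X.

(* A word in the letters x and x^-1 (x in X) is a sequence of pairs: (x, false)
   stands for x and (x, true) for x^-1. *)
Definition word_value w : G := \prod_(l <- w) (if l.2 then l.1^-1 else l.1).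

Definition reduced_word w : bool :=
  sorted [rel k l | (k.1 == l.1) ==> (k.2 == l.2)] w.

Definition free_basis X H : Prop :=
  generated X = H /\
  forall w, w <> [::] -> {in w, forall l, X l.1} -> reduced_word w ->
    word_value w <> 1.

Definition free_group H : Prop := exists X, free_basis X H.

Definition free_group_of_rank (n : nat) H : Prop :=
  exists2 X, (X #= `I_n)%card & free_basis X H.

Definition nonabelian H : Prop := exists x y, [/\ H x, H y & ~ commute x y].

End Groups.

Section LeftCosets.
Variables (G : groupType) (L : groupClosed G).

Definition lcoset_eq : rel G := fun g h => g^-1 * h \in L.

Fact lcoset_eq_refl : reflexive lcoset_eq.
Proof. by move=> g; rewrite /lcoset_eq mulVg gpred1. Qed.

Fact lcoset_eq_sym : symmetric lcoset_eq.
Proof. by move=> g h; rewrite /lcoset_eq -gpredV invgM invgK. Qed.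

Fact lcoset_eq_trans : transitive lcoset_eq.
Proof.
move=> h g k gh hk; rewrite /lcoset_eq -(mulVKg h k) mulgA.
exact: gpredM.
Qed.

Canonical lcoset_equiv :=
  EquivRel lcoset_eq lcoset_eq_refl lcoset_eq_sym lcoset_eq_trans.

Definition coset_space := {eq_quot lcoset_equiv}.
HB.instance Definition _ := Choice.on coset_space.
HB.instance Definition _ := EqQuotient.on coset_space.

(* Left translation g L |-> c g L; by translateE the choice of representative
   is immaterial. *)
Definition translate (c : G) (x : coset_space) : coset_space :=
  \pi_coset_space (c * repr x).

Lemma translateE (c g : G) :
  translate c (\pi_coset_space g) = \pi_coset_space (c * g).
Proof.
apply/eqmodP; rewrite /= /lcoset_eq invgM -mulgA mulKg.
by have /eqmodP := reprK (\pi_coset_space g).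
Qed.

Definition acts_freely (H : set G) : Prop :=
  forall c x, H c -> translate c x = x -> c = 1.

End LeftCosets.

(* Declared as a numClosedFieldType so that the library infers the norm topology. *)
Definition Cplx (R : realType) : numClosedFieldType := R[i].

Definition SL2C (R : realType) : Type := {A : 'M[Cplx R]_2 | (\det A == 1)%R}.

Section SL2C.
Variable R : realType.
Local Notation SL := (SL2C R).
Local Open Scope ring_scope.
Implicit Types A B : SL.

HB.instance Definition _ := SubType.on SL.
HB.instance Definition _ := Choice.on SL.

Fact SL2C_mul_subproof A B : \det (val A *m val B) == 1.
Proof. by rewrite det_mulmx (eqP (valP A)) (eqP (valP B)) mulr1. Qed.

Fact SL2C_one_subproof : \det (1%:M : 'M[Cplx R]_2) == 1.
Proof. by rewrite det1. Qed.

Fact SL2C_inv_subproof A : \det (invmx (val A)) == 1.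
Proof. by rewrite det_inv (eqP (valP A)) invr1. Qed.

Definition SL2C_mul A B : SL := Sub (val A *m val B) (SL2C_mul_subproof A B).
Definition SL2C_one : SL := Sub 1%:M SL2C_one_subproof.
Definition SL2C_inv A : SL := Sub (invmx (val A)) (SL2C_inv_subproof A).

Fact SL2C_unit A : val A \in unitmx.
Proof. by rewrite unitmxE (eqP (valP A)) unitr1. Qed.

Fact SL2C_mulA : associative SL2C_mul.
Proof. by move=> A B C; apply/val_inj; rewrite !SubK mulmxA. Qed.

Fact SL2C_mul1 : left_id SL2C_one SL2C_mul.
Proof. by move=> A; apply/val_inj; rewrite !SubK mul1mx. Qed.

Fact SL2C_mulr1 : right_id SL2C_one SL2C_mul.
Proof. by move=> A; apply/val_inj; rewrite !SubK mulmx1. Qed.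

Fact SL2C_mulV : left_inverse SL2C_one SL2C_inv SL2C_mul.
Proof. by move=> A; apply/val_inj; rewrite !SubK mulVmx ?SL2C_unit. Qed.

Fact SL2C_mulrV : right_inverse SL2C_one SL2C_inv SL2C_mul.
Proof. by move=> A; apply/val_inj; rewrite !SubK mulmxV ?SL2C_unit. Qed.

HB.instance Definition _ := isGroup.Build SL
  SL2C_mulA SL2C_mul1 SL2C_mulr1 SL2C_mulV SL2C_mulrV.

HB.instance Definition _ := Topological.copy SL
  (initial_topology (val : SL -> 'M[Cplx R]_2)).

End SL2C.

(* A cocompact (uniform) lattice is a discrete subgroup L such that the space
   G / L is compact for the quotient topology. *)
Definition cocompact_lattice (R : realType) (L : groupClosed (SL2C R)) : Prop :=
  [set` L] `<=` isolated [set` L] /\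
  compact [set: quotient_topology (coset_space L)].

(* Main.v *)
(* If a reduced word w(g1, g2) <> 1 fixes a point g Lambda, then it is conjugate
   to an element of Lambda, so its trace lies in the trace set of Lambda.  As
   Lambda is discrete it is countable, and F is taken to be the set of pairs at
   which tr w(g1, g2) <> tr A for every nonempty reduced word w and every A in
   Lambda (A = 1 yields freeness of the group).  F is a countable intersection
   of open sets.  Density needs no Baire argument: through every pair there is
   a polynomial curve z |-> (g1(z), g2(z)) in SL_2 x SL_2 whose leading
   coefficients are rank one matrices in general position, so that
   tr w(g1(z), g2(z)) is a nonconstant polynomial in z for each w, and all but
   countably many points of the curve lie in F. *)
Require Import Defs.
From mathcomp Require Import all_boot all_order all_algebra.
From mathcomp Require Import ring lra.
From mathcomp Require Import all_classical all_reals topology borel_hierarchy.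
From mathcomp Require Import normedtype lebesgue_measure complex.

Set Implicit Arguments.
Unset Strict Implicit.
Unset Printing Implicit Defensive.

Import Order.TTheory GRing.Theory Num.Theory numFieldNormedType.Exports.

Local Open Scope classical_set_scope.
Local Open Scope ring_scope.

(** * Explicit 2x2 matrices *)

Definition mx2 (K : Type) (a b c d : K) : 'M[K]_2 :=
  \matrix_(i, j) (if i == 0 then if j == 0 then a else b
                  else if j == 0 then c else d).

Lemma ord2E (i : 'I_2) : i = 0 \/ i = 1.
Proof.
by case: i => [[|[|i]] Hi] //; [left | right]; apply/val_inj.
Qed.

Section Mx2.
Variable K : comNzRingType.
Implicit Types (a b c d : K) (A : 'M[K]_2).

Lemma matrix2P (A B : 'M[K]_2) :
  [/\ A 0 0 = B 0 0, A 0 1 = B 0 1, A 1 0 = B 1 0 & A 1 1 = B 1 1] -> A = B.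
Proof.
case=> e00 e01 e10 e11; apply/matrixP => i j.
by case: (ord2E i) => ->; case: (ord2E j) => ->.
Qed.

Lemma mx2_eta A : A = mx2 (A 0 0) (A 0 1) (A 1 0) (A 1 1).
Proof. by apply: matrix2P; rewrite !mxE. Qed.

Lemma mulmx2 a b c d a' b' c' d' :
  mx2 a b c d *m mx2 a' b' c' d' =
  mx2 (a * a' + b * c') (a * b' + b * d') (c * a' + d * c') (c * b' + d * d').
Proof.
by apply: matrix2P; rewrite !mxE !big_ord_recl !big_ord0 !mxE /= !addr0; split.
Qed.

Lemma det_mx2 a b c d : \det (mx2 a b c d) = a * d - b * c.
Proof.
rewrite (expand_det_row _ 0) !big_ord_recl big_ord0 /cofactor !det_mx11 !mxE /=.
by rewrite expr0 expr1 addr0 mul1r mulN1r mulrN.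
Qed.

Lemma adj_mx2 a b c d : \adj (mx2 a b c d) = mx2 d (- b) (- c) a.
Proof.
by apply: matrix2P; rewrite !mxE /cofactor !det_mx11 !mxE /=
  ?expr0 ?expr1 ?expr2 ?mulrNN ?mul1r ?mulN1r.
Qed.

End Mx2.

(** * Leading coefficients of polynomial matrices *)

Section Leading.
Variable K : comNzRingType.

(** Here [k] only bounds the degrees and [A] may vanish, so the relation is stable under products
    even when leading terms cancel. *)
Definition leading_mx m n (k : nat) (P : 'M[{poly K}]_(m, n))
    (A : 'M[K]_(m, n)) :=
  forall i j, (size (P i j) <= k.+1)%N /\ (P i j)`_k = A i j.

Lemma leading_polyM k l (p q : {poly K}) :
  (size p <= k.+1)%N -> (size q <= l.+1)%N ->
  (size (p * q)%R <= (k + l).+1)%N /\ (p * q)`_(k + l) = p`_k * q`_l.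
Proof.
move=> hp hq; split.
  apply: leq_trans (size_polyMleq _ _) _.
  by rewrite -subn1 leq_subLR add1n (leq_trans (leq_add hp hq)) // addSn addnS.
have hk : (k < (k + l).+1)%N by rewrite ltnS leq_addr.
(* Only the index [k] contributes: below it the coefficient of [q] is past its degree bound, above
   it that of [p] is. *)
rewrite coefM (bigD1 (Ordinal hk)) //= addKn big1 ?addr0 // => i ik.
have [ltik|leki] := ltnP i k.
  rewrite [q`__]nth_default ?mulr0 //; apply: leq_trans hq _.
  by rewrite -addnBAC ?(ltnW ltik) // -add1n leq_add2r subn_gt0.
rewrite [p`__]nth_default ?mul0r //; apply: leq_trans hp _.
by rewrite ltn_neqAle leki andbT eq_sym; apply: contraNneq ik => e;
  apply/eqP/val_inj.
Qed.

Lemma leading_mxM m n r k l (P : 'M[{poly K}]_(m, n)) (Q : 'M_(n, r)) A B :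
  leading_mx k P A -> leading_mx l Q B -> leading_mx (k + l) (P *m Q) (A *m B).
Proof.
move=> hP hQ i j; rewrite !mxE; split.
  apply: leq_trans (size_sum _ _ _) _; apply/bigmax_leqP => s _.
  by have [] := leading_polyM (proj1 (hP i s)) (proj1 (hQ s j)).
rewrite coef_sum; apply: eq_bigr => s _.
have [sP <-] := hP i s; have [sQ <-] := hQ s j.
by have [] := leading_polyM sP sQ.
Qed.

(** For 2x2 matrices the adjugate is linear in the entries, so the degree bound does not grow. *)
Lemma leading_mx_adj k (P : 'M[{poly K}]_2) A :
  leading_mx k P A -> leading_mx k (\adj P) (\adj A).
Proof.
rewrite [P]mx2_eta [A]mx2_eta !adj_mx2 => h i j.
have := (h 0 0, h 0 1, h 1 0, h 1 1); rewrite !mxE /=.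
move=> [[[[? ?] [? ?]] [? ?]] [? ?]].
by case: (ord2E i) => ->; case: (ord2E j) => -> /=;
  rewrite ?size_polyN ?coefN; split=> //; congr -%R.
Qed.

Lemma leading_mxC m n (A : 'M[K]_(m, n)) : leading_mx 0 (map_mx polyC A) A.
Proof.
by move=> i j; rewrite !mxE coefC /=; split=> //; exact: size_polyC_leq1.
Qed.

Lemma leading_mxtrace n k (P : 'M[{poly K}]_n) A :
  leading_mx k P A -> (\tr P)`_k = \tr A.
Proof.
by move=> h; rewrite coef_sum; apply: eq_bigr => i _; have [] := h i i.
Qed.

End Leading.

(* Letters of the free group on two generators are encoded as in [word_value],
   with generators indexed by [bool]. *)
Definition compatible : rel (bool * bool) :=
  [rel k l | (k.1 == l.1) ==> (k.2 == l.2)].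

(** * Words evaluated in 2x2 matrices *)

Section WordMx.
Variable K : comNzRingType.
Implicit Types (x : bool -> 'M[K]_2) (l : bool * bool) (w : seq (bool * bool)).

(** The adjugate is the inverse when the determinant is 1, and it still makes sense over polynomials
    and for the singular leading coefficients. *)
Definition letter_mx x l : 'M[K]_2 := if l.2 then \adj (x l.1) else x l.1.

Definition word_mx x w : 'M[K]_2 := \big[mulmx/1%:M]_(l <- w) letter_mx x l.

Lemma word_mx_nil x : word_mx x [::] = 1%:M.
Proof. exact: big_nil. Qed.

Lemma word_mx_cons x l w : word_mx x (l :: w) = letter_mx x l *m word_mx x w.
Proof. exact: big_cons. Qed.

Lemma word_mx_rcons x l w :
  word_mx x (rcons w l) = word_mx x w *m letter_mx x l.
Proof.
elim: w => [|k w IH] /=.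
  by rewrite word_mx_cons !word_mx_nil mulmx1 mul1mx.
by rewrite !word_mx_cons IH mulmxA.
Qed.

Lemma letter_mxV x l : (forall b, \det (x b) = 1) ->
  letter_mx x (l.1, ~~ l.2) *m letter_mx x l = 1%:M.
Proof.
by move=> dx; case: l => b []; rewrite /letter_mx /= ?mul_mx_adj ?mul_adj_mx dx.
Qed.

End WordMx.

Lemma leading_word_mx (K : comNzRingType) k (P : bool -> 'M[{poly K}]_2) A w :
  (forall b, leading_mx k (P b) (A b)) ->
  leading_mx (k * size w) (word_mx P w) (word_mx A w).
Proof.
move=> h; elim: w => [|l w IH].
  rewrite muln0 !word_mx_nil -(map_mx1 (@polyC K)); exact: leading_mxC.
rewrite !word_mx_cons mulnS; apply: leading_mxM IH.
by rewrite /letter_mx; case: l.2; [apply: leading_mx_adj|].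
Qed.

Lemma map_word_mx (K L : comNzRingType) (f : {rmorphism K -> L}) x w :
  map_mx f (word_mx x w) = word_mx (fun b => map_mx f (x b)) w.
Proof.
elim: w => [|l w IH]; first by rewrite !word_mx_nil map_mx1.
rewrite !word_mx_cons map_mxM IH; congr (_ *m _).
by rewrite /letter_mx; case: l.2; rewrite ?map_mx_adj.
Qed.

(** * Polynomial curves in SL_2 and traces of words along them *)

Section Schottky.
Variable K : numFieldType.

(* [limit_mx true] is the conjugate of [limit_mx false] by [[1, 1], [1, 2]]; this
   choice makes the products in [limit_row_col] nonzero. *)
Definition limit_mx (b : bool) : 'M[K]_2 :=
  if b then mx2 2 (-1) 2 (-1) else mx2 1 0 0 0.

(** With [limit_row], the column and row factors of the rank one matrix [letter_mx limit_mx l]. *)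
Definition limit_col (l : bool * bool) : 'cV[K]_2 :=
  \col_i (if i == 0 then (if l.1 then 1 else (~~ l.2)%:R)
          else (if l.1 then (l.2.+1)%:R else l.2%:R)).

Definition limit_row (l : bool * bool) : 'rV[K]_2 :=
  \row_j (if j == 0 then (if l.1 then (if l.2 then -1 else 2) else (~~ l.2)%:R)
          else (if l.1 then (if l.2 then 1 else -1) else l.2%:R)).

Lemma letter_limit_mx l : letter_mx limit_mx l = limit_col l *m limit_row l.
Proof.
case: l => [[] []]; rewrite /letter_mx /= ?adj_mx2; apply: matrix2P;
  rewrite !mxE !big_ord_recl !big_ord0 !mxE /=; split; ring.
Qed.

(** The kernel of [limit_row l] is the line of the column of the inverse letter, and the four
    columns (1,0), (0,1), (1,1), (1,2) span distinct lines. *)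
Lemma limit_row_col l m :
  compatible l m -> (limit_row l *m limit_col m) 0 0 != 0.
Proof.
case: l => [[] []]; case: m => [[] []] //= _;
  rewrite !mxE !big_ord_recl !big_ord0 !mxE /=
    ?(mulr0, mul0r, mul1r, mulr1, addr0, add0r, mulN1r, subrr, oner_eq0) //;
  rewrite ?[2]mulr2n ?addrK ?addKr ?oppr_eq0 ?oner_eq0 -?mulr2n ?pnatr_eq0 //.
Qed.

(** In a product of rank one matrices each inner row-column pair is a scalar; only the outer column
    and row survive. *)
Lemma word_limit_mx l w : path compatible l w ->
  exists2 c, c != 0 &
    word_mx limit_mx (l :: w) = c *: (limit_col l *m limit_row (last l w)).
Proof.
elim: w l => [|m w IH] l /=.
  exists 1; first exact: oner_neq0.
  by rewrite scale1r word_mx_cons word_mx_nil mulmx1 letter_limit_mx.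
case/andP=> lm /IH[c c0 e]; exists (c * (limit_row l *m limit_col m) 0 0).
  by rewrite mulf_neq0 // limit_row_col.
rewrite word_mx_cons e letter_limit_mx -scalemxAr -mulmxA.
rewrite [limit_row l *m (_ *m _)]mulmxA {1}[limit_row l *m limit_col m]mx11_scalar.
by rewrite mul_scalar_mx -scalemxAr scalerA.
Qed.

(* Cyclic reduction preserves the trace, and for a cyclically reduced word the
   leading coefficient is a product of the scalars of [limit_row_col]. *)
Lemma mxtrace_word_nonconstant k (P : bool -> 'M[{poly K}]_2) w :
  (0 < k)%N -> (forall b, \det (P b) = 1) ->
  (forall b, leading_mx k (P b) (limit_mx b)) ->
  w != [::] -> sorted compatible w -> (1 < size (\tr (word_mx P w)))%N.
Proof.
move=> k0 dP lP; have [n] := ubnP (size w).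
elim: n w => // n IH [|l w] // ltn _ pw.
have [cyc|ncyc] := boolP (compatible (last l w) l).
  have [c c0 e] := word_limit_mx pw.
  have := leading_mxtrace (leading_word_mx (l :: w) lP).
  rewrite e mxtraceZ mxtrace_mulC [_ *m _]mx11_scalar mxtrace_scalar mulr1n => tr.
  have : (\tr (word_mx P (l :: w)))`_(k * size (l :: w)) != 0.
    by rewrite tr mulf_neq0 // limit_row_col.
  apply: contraR; rewrite -leqNgt => sz; rewrite nth_default //.
  by apply: leq_trans sz _; rewrite muln_gt0 k0.
case/lastP: w => [|w m] in ltn pw ncyc *.
  by rewrite /compatible /= !eqxx in ncyc.
rewrite last_rcons /compatible /= negb_imply in ncyc.
have {ncyc} em : l = (m.1, ~~ m.2).
  by case: l m ncyc {ltn pw} => [[] []] [[] []].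
rewrite /= rcons_path in pw; case/andP: pw => pw lm.
rewrite word_mx_cons word_mx_rcons mxtrace_mulC -mulmxA em.
have := letter_mxV (m.1, ~~ m.2) dP; rewrite /= negbK -surjective_pairing => ->.
rewrite mulmx1; apply: IH.
- by move: ltn; rewrite /= size_rcons ltnS; apply: ltn_trans.
(* If the middle were empty, the word would be a letter next to its inverse, hence not reduced. *)
- by case: w lm {pw ltn} => //=; rewrite em; case: m {em} => [[] []].
- exact: path_sorted pw.
Qed.

(* A matrix in SL_2 is a product E(a) F(b) E(c) F(d) of elementary unipotents;
   shifting every parameter by 'X gives a curve with leading term
   E12 E21 E12 E21 'X^4. *)
Lemma SL2_curve (g : 'M[K]_2) : \det g = 1 ->
  exists P : 'M[{poly K}]_2, [/\ \det P = 1, map_mx (horner_eval 0) P = g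
    & leading_mx 4 P (mx2 1 0 0 0)].
Proof.
pose E (L : comNzRingType) (a : L) := mx2 1 a 0 1.
pose F (L : comNzRingType) (a : L) := mx2 1 0 a 1.
rewrite [g]mx2_eta det_mx2; set p := g 0 0; set q := g 0 1; set r := g 1 0.
set s := g 1 1 => dg.
have [a [b [c [d eg]]]] : exists a b c d,
    mx2 p q r s = E K a *m F K b *m E K c *m F K d.
  (* Right multiplication by [F(-d)] makes the lower left entry [r - s * d]. Once this is nonzero,
     the matrix factors as [E F E]; 0 or 1 works for [d] since [r] and [s] are not both 0. *)
  have [d rd] : exists d, r - s * d != 0.
    have [r0|] := eqVneq r 0; last by exists 0; rewrite mulr0 subr0.
    exists 1; rewrite mulr1 r0 sub0r oppr_eq0; apply: contra_eq_neq dg => ->.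
    by rewrite r0 !mulr0 subrr eq_sym oner_eq0.
  exists ((p - q * d - 1) / (r - s * d)), (r - s * d).
  exists ((s - 1) / (r - s * d)), d.
  have : q = ((p - q * d) * s - 1) / (r - s * d).
    by apply: (mulIf rd); rewrite divfK // -dg; ring.
  rewrite -{2}(subrK (q * d) p) -{2}(subrK (s * d) r).
  move: (p - q * d) (r - s * d) rd => p' r' rd ->.
  by rewrite /E /F !mulmx2; congr mx2; field.
exists (E _ (a%:P + 'X) *m F _ (b%:P + 'X) *m E _ (c%:P + 'X)
          *m F _ (d%:P + 'X)).
have lE (a0 : K) : leading_mx 1 (E {poly K} (a0%:P + 'X)) (mx2 0 1 0 0).
  move=> i j.
  have sX : (size (a0%:P + 'X)%R <= 2)%N by rewrite addrC size_XaddC.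
  by case: (ord2E i) => ->; case: (ord2E j) => ->;
    rewrite !mxE /= ?size_poly1 ?size_poly0 ?coef0 ?coef1 ?coefD ?coefC ?coefX
      ?add0r.
have lF (a0 : K) : leading_mx 1 (F {poly K} (a0%:P + 'X)) (mx2 0 0 1 0).
  move=> i j.
  have sX : (size (a0%:P + 'X)%R <= 2)%N by rewrite addrC size_XaddC.
  by case: (ord2E i) => ->; case: (ord2E j) => ->;
    rewrite !mxE /= ?size_poly1 ?size_poly0 ?coef0 ?coef1 ?coefD ?coefC ?coefX
      ?add0r.
split.
- by rewrite !det_mulmx !det_mx2; ring.
- rewrite eg !map_mxM; congr (_ *m _ *m _ *m _); apply: matrix2P;
    by rewrite !mxE /= /horner_eval !hornerE.
- have := leading_mxM (leading_mxM (leading_mxM (lE a) (lF b)) (lE c)) (lF d).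
  by rewrite !mulmx2 !(mulr0, mul0r, mulr1, addr0, add0r).
Qed.

(** [SL2_curve] always gives the leading term [limit_mx false]. For the second matrix it is applied
    to a conjugate by [C]; conjugating back turns this term into [limit_mx true]. *)
Lemma SL2_pair_curve (g : bool -> 'M[K]_2) : (forall b, \det (g b) = 1) ->
  exists P : bool -> 'M[{poly K}]_2, [/\ forall b, \det (P b) = 1,
    forall b, map_mx (horner_eval 0) (P b) = g b &
    forall b, leading_mx 4 (P b) (limit_mx b)].
Proof.
move=> dg; pose C : 'M[K]_2 := mx2 1 1 1 2.
pose C' : 'M[K]_2 := mx2 2 (-1) (-1) 1.
have CC' : C *m C' = 1%:M.
  by rewrite mulmx2; apply: matrix2P; rewrite !mxE /=; split; ring.
have dCC' : \det C' * \det C = 1 by rewrite mulrC -det_mulmx CC' det1.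
have [P0 [dP0 eP0 lP0]] := SL2_curve (dg false).
have [|P1 [dP1 eP1 lP1]] := @SL2_curve (C' *m g true *m C).
  by rewrite !det_mulmx dg mulr1.
pose mC := map_mx (@polyC K).
exists (fun b => if b then mC _ _ C *m P1 *m mC _ _ C' else P0); split=> -[] //.
- by rewrite !det_mulmx dP1 mulr1 -det_mulmx -map_mxM CC' map_mx1 det1.
- have hC m n (A : 'M[K]_(m, n)) : map_mx (horner_eval 0) (mC _ _ A) = A.
    by apply/matrixP => i j; rewrite !mxE /horner_eval hornerC.
  by rewrite !map_mxM !hC eP1 !mulmxA CC' mul1mx -mulmxA CC' mulmx1.
- have := leading_mxM (leading_mxM (leading_mxC C) lP1) (leading_mxC C').
  by rewrite !mulmx2 !(mulr0, mul0r, mul1r, mulr1, addr0, add0r).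
Qed.

End Schottky.

Local Close Scope ring_scope.

(** * Words in two group elements, freeness, and stabilizers of cosets *)

Section FreeWords.
Local Open Scope group_scope.
Variable G : groupType.
Implicit Types (x : bool -> G) (w : seq (bool * bool)).

Definition subst_word x w : seq (G * bool) := [seq (x l.1, l.2) | l <- w].

Definition word_at x w : G := word_value (subst_word x w).

Lemma word_at_nil x : word_at x [::] = 1.
Proof. exact: big_nil. Qed.

Lemma word_at_cons x l w :
  word_at x (l :: w) = (if l.2 then (x l.1)^-1 else x l.1) * word_at x w.
Proof. exact: big_cons. Qed.

Lemma word_at_cat x w1 w2 : word_at x (w1 ++ w2) = word_at x w1 * word_at x w2.
Proof. by rewrite /word_at /subst_word map_cat; exact: big_cat. Qed.

Lemma word_atV x w : exists w', word_at x w' = (word_at x w)^-1.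
Proof.
elim: w => [|l w [w' e]]; first by exists [::]; rewrite word_at_nil invg1.
exists (w' ++ [:: (l.1, ~~ l.2)]).
rewrite word_at_cat !word_at_cons word_at_nil mulg1 e invgM /=.
by case: l.2; rewrite ?invgK.
Qed.

(** Induction on the word: a new letter is either kept in front of the reduced tail or cancels its
    head. *)
Lemma reduced_word_at x w :
  exists2 w', sorted compatible w' & word_at x w' = word_at x w.
Proof.
elim: w => [|l w [w' red e]]; first by exists [::].
case: w' => [|m w'] in red e *.
  by exists [:: l] => //; rewrite !word_at_cons -e.
have [lm|] := boolP (compatible l m).
  exists (l :: m :: w'); first by rewrite /= lm.
  by rewrite word_at_cons e -word_at_cons.
rewrite /compatible /= negb_imply => /andP[/eqP l1 l2].
exists w'; first exact: path_sorted red.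
rewrite word_at_cons -e word_at_cons mulgA l1.
by case: l.2 m.2 l2 => [] [] //= _; rewrite ?mulVg ?mulgV mul1g.
Qed.

Lemma generated_pair x g : generated [set x false; x true] g ->
  exists w, word_at x w = g.
Proof.
pose H := [set h | exists w, word_at x w = h].
apply: (@smallest_sub _ _ _ H); last first.
  by move=> _ [->|->]; [exists [:: (false, false)] | exists [:: (true, false)]];
    rewrite word_at_cons word_at_nil mulg1.
split; first by apply/mem_set; exists [::]; exact: word_at_nil.
move=> _ _ /set_mem[w1 <-] /set_mem[w2 <-]; apply/mem_set.
by have [w2' e] := word_atV x w2; exists (w1 ++ w2'); rewrite word_at_cat e.
Qed.

Section FreePair.
Variable x : bool -> G.
Hypothesis freex : forall w, w != [::] -> sorted compatible w -> word_at x w <> 1.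

(** Needed because [reduced_word] compares group elements while [compatible] compares their
    indices. *)
Lemma free_pair_inj : injective x.
Proof.
suff xFT : x false <> x true by move=> [] [] // e; case: xFT.
move=> e; apply: (freex (w := [:: (false, false); (true, true)])) => //.
by rewrite !word_at_cons word_at_nil /= e mulg1 mulgV.
Qed.

Lemma free_pair_basis :
  free_basis [set x false; x true] (generated [set x false; x true]).
Proof.
split=> // w w0 wX.
have [w' ew] : exists w', w = subst_word x w'.
  elim: w wX {w0} => [|l w IH] wX; first by exists [::].
  have [k kw|w' ew] := IH; first by apply: wX; rewrite inE kw orbT.
  have : exists b, l.1 = x b.
    by have [->|->] := wX l (mem_head _ _); [exists false | exists true].
  by case=> b lb; exists ((b, l.2) :: w'); rewrite /= -lb -surjective_pairing ew.
rewrite ew /reduced_word sorted_map => red; apply: freex.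
  by apply/eqP => w'0; apply: w0; rewrite ew w'0.
rewrite (eq_sorted (e' := compatible)) // in red.
by move=> k l /=; rewrite (inj_eq free_pair_inj).
Qed.

Lemma free_pair_rank : free_group_of_rank 2 (generated [set x false; x true]).
Proof.
exists [set x false; x true]; last exact: free_pair_basis.
have -> : [set x false; x true] = [set x (n == 1%N) | n in `I_2].
  rewrite eqEsubset; split=> [_ [->|->]|_ [[|[|n]] //= _ <-]].
  - by exists 0%N.
  - by exists 1%N.
  - by left.
  - by right.
apply: inj_card_eq => -[|[|m]] [|[|n]]; rewrite !inE //=.
all: by move=> _ _ /free_pair_inj.
Qed.

Lemma free_pair_nonabelian : nonabelian (generated [set x false; x true]).
Proof.
exists (x false), (x true); split.
- by apply: sub_gen_smallest; left.
- by apply: sub_gen_smallest; right.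
move=> com; apply: (freex
  (w := [:: (false, false); (true, false); (false, true); (true, true)])) => //.
rewrite !word_at_cons word_at_nil /= mulg1 mulgA com -mulgA.
by rewrite [x false * _]mulgA mulgV mul1g mulgV.
Qed.

End FreePair.

(** The stabilizer of the coset [g L] is the conjugate subgroup [g L g^-1]. *)
Lemma acts_freely_conj (L : groupClosed G) (H : set G) :
  (forall c g, H c -> g^-1 * c * g \in L -> c = 1) -> acts_freely L H.
Proof.
move=> hH c X Hc; rewrite -[X]reprK translateE => /eqmodP /=.
rewrite /lcoset_eq invgM => cL; apply: (hH _ (repr X) Hc).
by rewrite -gpredV !invgM invgK mulgA.
Qed.

End FreeWords.

(** * Continuity of word entries and countable intersections of open sets *)

Section Topology.
Local Open Scope ring_scope.

Lemma continuous_mx (T : topologicalType) (U : topologicalType) m n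
    (f : T -> 'M[U]_(m, n)) :
  (forall i j, continuous (fun t => f t i j)) -> continuous f.
Proof.
move=> cf t A [P nP sPA]; have : \forall s \near t, forall i j, P i j (f s i j).
  apply: filter_forall => i; apply: filter_forall => j; exact: cf.
by apply: filterS => s Ps; exact: sPA.
Qed.

Section Numfield.
Variable K : numFieldType.

Lemma continuous_horner_num (p : {poly K}) : continuous (horner p).
Proof.
elim/poly_ind: p => [|p c IH] z.
  have -> : horner (0 : {poly K}) = fun=> 0.
    by apply/funext => y; rewrite horner0.
  exact: cst_continuous.
have -> : horner (p * 'X + c%:P) = fun y => p.[y] * y + c.
  by apply/funext => y; rewrite !hornerE.
apply: (@cvgD _ _ _ (nbhs z)); last exact: cst_continuous.
by apply: (@cvgM _ _ (nbhs z)); [exact: IH | exact: cvg_id].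
Qed.

Lemma continuous_word_mx (T : topologicalType) (x : T -> bool -> 'M[K]_2) w :
  (forall b i j, continuous (fun t => x t b i j)) ->
  forall i j, continuous (fun t => word_mx (x t) w i j).
Proof.
move=> cx; elim: w => [|l w IH] i j t.
  rewrite (_ : (fun _ => _) = fun=> (1%:M : 'M[K]_2) i j).
    exact: cst_continuous.
  by apply/funext => s; rewrite word_mx_nil.
have cl i' j' : continuous (fun t => letter_mx (x t) l i' j').
  rewrite /letter_mx; case: l.2; last exact: cx.
  have -> : (fun s => \adj (x s l.1) i' j') = fun s =>
      mx2 (x s l.1 1 1) (- x s l.1 0 1) (- x s l.1 1 0) (x s l.1 0 0) i' j'.
    by apply/funext => s; rewrite -adj_mx2 -mx2_eta.
  move=> s; case: (ord2E i') => ->; case: (ord2E j') => -> /=;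
    under eq_fun do rewrite mxE /=.
  - exact: cx.
  - by apply: cvgN; exact: cx.
  - by apply: cvgN; exact: cx.
  - exact: cx.
rewrite (_ : (fun _ => _) = fun s =>
  letter_mx (x s) l i 0 * word_mx (x s) w 0 j +
  letter_mx (x s) l i 1 * word_mx (x s) w 1 j).
  by apply: cvgD; apply: cvgM; (exact: cl || exact: IH).
apply/funext => s; rewrite word_mx_cons mxE !big_ord_recl big_ord0 addr0.
by rewrite (_ : lift ord0 ord0 = 1) //; apply/val_inj.
Qed.

End Numfield.
End Topology.

Lemma Gdelta_bigcap (T : topologicalType) (I : Type) (D : set I)
    (F : I -> set T) :
  countable D -> (forall i, D i -> open (F i)) ->
  Gdelta (\bigcap_(i in D) F i).
Proof.
(* A countable set is empty or the image of the naturals; the empty intersection is written with the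
   constant sequence [setT]. *)
move=> cD oF; have [D0|[f]] := pfcard_geP cD.
  rewrite D0 bigcap_set0; exists (fun=> setT); last by rewrite bigcap_const.
  by move=> _; exact: openT.
exists (fun n => F (f n)); first by move=> n; apply: oF; exact: funS.
rewrite eqEsubset; split=> t Ft; first by move=> n _; apply: Ft; exact: funS.
move=> i Di; have [n _ <-] := 'surj_f Di; exact: Ft.
Qed.

(** * Discrete subsets of SL_2(C), traces, and generic pairs *)

Section SL2C.
Variable R : realType.
Local Notation SL := (SL2C R).
Local Notation C := (Cplx R).
Local Open Scope ring_scope.

Lemma nbhs_SL2C (A : SL) (U : set SL) : nbhs A U ->
  exists2 e : R, 0 < e & forall B : SL,
    (forall i j, `|val A i j - val B i j| < (e%:C)%C) -> U B.
Proof.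
case=> V [[W oW <-] WA VU].
have /nbhs_ballP[e e0 eW] : nbhs (val A) W by exact: open_nbhs_nbhs.
(* A positive element for the order on complex numbers is real. *)
have er : (complex.Re e)%:C%C = e by exact/RRe_real/gtr0_real.
exists (complex.Re e); first by rewrite -ltcR er.
by move=> B AB; apply/VU/eW; split=> // i j; rewrite -er; exact: AB.
Qed.

Lemma normc_le_Re_Im (z : C) :
  `|z| <= ((`|complex.Re z| + `|complex.Im z|)%:C)%C.
Proof.
rewrite normc_def lecR -[leRHS]ger0_norm ?addr_ge0 //.
rewrite -[leRHS]sqrtr_sqr ler_wsqrtr //.
by rewrite sqrrD !real_normK ?num_real // lerD2r lerDl mulrn_wge0 // mulr_ge0.
Qed.

Lemma floor_eq_dist (a b : R) : Num.floor a = Num.floor b -> `|a - b| < 1.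
Proof.
move=> eab; have := floorD1_gt b; have := floor_le b.
have := floorD1_gt a; have := floor_le a; rewrite eab intrD /=.
move: (Num.floor b)%:~R => c ca ac cb bc.
by rewrite ltr_norml; apply/andP; split; lra.
Qed.

(** Each point gets a mesh [1 / N.+1] so fine that no other point of [L] is within twice the mesh.
    The pair of [N] and the rounded entries then determines the point; the factor 2 adds up real and
    imaginary parts. *)
Lemma countable_isolated_SL2C (L : set SL) : L `<=` isolated L -> countable L.
Proof.
move=> isoL.
have /choice[N NP] : forall A : SL, exists n : nat, L A -> forall B, L B ->
    (forall i j, `|val A i j - val B i j| < ((2 / n.+1%:R)%:C)%C) -> A = B.
  move=> A; have [LA|] := pselect (L A); last by exists 0%N.
  have [_ [V /nbhs_SL2C[e e0 eV] VL]] := isoL _ LA.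
  have [n ne] : exists n, 2 / n.+1%:R < e.
    exists (Num.trunc (2 / e)); rewrite ltr_pdivrMr ?ltr0n // mulrC.
    rewrite -ltr_pdivrMr //; exact: truncnS_gt.
  exists n => _ B LB AB; have : [set A] B.
    rewrite -VL; split=> //; apply: eV => i j; apply: lt_trans (AB i j) _.
    by rewrite ltcR.
  by move=> ->.
pose f (A : SL) : nat * 'M[int * int]_2 :=
  (N A, \matrix_(i, j) (Num.floor ((N A).+1%:R * complex.Re (val A i j)),
                        Num.floor ((N A).+1%:R * complex.Im (val A i j)))).
apply/countable_injP; exists (pickle \o f) => A B.
rewrite !inE => LA LB /(pcan_inj pickleK) [eN ef].
apply: (NP _ LA _ LB) => i j; apply: le_lt_trans (normc_le_Re_Im _) _.
have := congr1 (fun M : 'M__ => M i j) ef; rewrite !mxE -eN => -[eRe eIm].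
have close (a b : R) :
    Num.floor ((N A).+1%:R * a) = Num.floor ((N A).+1%:R * b) ->
    `|a - b| < (N A).+1%:R^-1.
  move=> eab.
  have n0 : 0 < (N A).+1%:R :> R by rewrite ltr0n.
  rewrite -(ltr_pM2l n0) mulfV ?gt_eqF //.
  rewrite -{1}[_.+1%:R]gtr0_norm // -normrM mulrBr.
  exact: floor_eq_dist.
rewrite ltcR !raddfB mulrDl mul1r; apply: ltrD; exact: close.
Qed.

(** Otherwise the interval from 0 to [e] would be countable, hence of Lebesgue measure 0. *)
Lemma exists_real_avoiding (B : set C) (e : R) : countable B -> 0 < e ->
  exists t : R, [/\ 0 < t, t < e & ~ B (t%:C)%C].
Proof.
move=> cB e0; apply: contrapT => noT.
have cA : countable [set t : R | B (t%:C)%C].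
  have inj : {in [set t : R | B (t%:C)%C] &,
      injective (fun t : R => (t%:C)%C : C)}.
    by move=> s t _ _; exact: complexI.
  have /card_eqPle[_ le] := inj_card_eq inj; apply: sub_countable le _.
  by apply: sub_countable cB; apply: subset_card_le => _ [t Bt <-].
have : countable `]0, e[%classic.
  apply: sub_countable cA; apply: subset_card_le => t /=.
  rewrite in_itv => /andP[t0 te]; apply: contrapT => nB; apply: noT; by exists t.
move/countable_lebesgue_measure0; rewrite lebesgue_measure_itv /= lte_fin e0.
by rewrite sube0 => -[e1]; rewrite e1 ltxx in e0.
Qed.

Lemma countable_roots (p : {poly C}) : p != 0 -> countable [set z | root p z].
Proof.
move=> p0; have [r er] := closed_field_poly_normal p.
apply: finite_set_countable; apply: sub_finite_set (finite_seq r) => z /=.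
by rewrite er rootZ ?lead_coef_eq0 // root_prod_XsubC.
Qed.

Lemma val_SL2C_V (A : SL) : val A^-1%g = \adj (val A).
Proof.
by rewrite -[LHS]/(invmx (val A)) /invmx SL2C_unit (eqP (valP A)) invr1 scale1r.
Qed.

Lemma val_word_at (x : bool -> SL) w :
  val (word_at x w) = word_mx (fun b => val (x b)) w.
Proof.
elim: w => [|l w IH]; first by rewrite word_at_nil word_mx_nil.
rewrite word_at_cons word_mx_cons -IH /letter_mx.
by case: l.2; rewrite -?val_SL2C_V.
Qed.

Definition trace (A : SL) : C := \tr (val A).

Lemma trace_conj (A B : SL) : trace (B^-1 * A * B)%g = trace A.
Proof.
rewrite /trace -[val (_ * B)%g]/(val B^-1%g *m val A *m val B).
rewrite mxtrace_mulC mulmxA.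
by rewrite -[val B *m val B^-1%g]/(val (B * B^-1)%g) mulgV mul1mx.
Qed.

Definition of_pair (T : Type) (g : T * T) (b : bool) : T :=
  if b then g.2 else g.1.

Lemma continuous_trace_word w :
  continuous (fun g : SL * SL => trace (word_at (of_pair g) w)).
Proof.
have cw i j :
    continuous (fun g : SL * SL => val (word_at (of_pair g) w) i j).
  under eq_fun do rewrite val_word_at.
  apply: continuous_word_mx => b k l g.
  apply: (@continuous_comp _ _ _ (fun g : SL * SL => val (of_pair g b))
    (fun M : 'M[C]_2 => M k l));
    last exact: coord_continuous.
  apply: (@continuous_comp _ _ _ (fun g : SL * SL => of_pair g b)
    (val : SL -> 'M[C]_2));
    last exact: initial_continuous.
  by case: b; [exact: cvg_snd | exact: cvg_fst].
have -> : (fun g : SL * SL => trace (word_at (of_pair g) w)) = fun g =>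
    val (word_at (of_pair g) w) 0 0 + val (word_at (of_pair g) w) 1 1.
  apply/funext => h; rewrite /trace /mxtrace !big_ord_recl big_ord0 addr0.
  by rewrite (_ : lift ord0 ord0 = 1) //; apply/val_inj.
by move=> g; apply: (@cvgD _ _ _ (nbhs g)); exact: cw.
Qed.

Lemma generic_pair_acts_freely (L : groupClosed SL) (x : bool -> SL) :
  (forall w A, w != [::] -> sorted compatible w -> A \in L ->
    trace (word_at x w) <> trace A) ->
  acts_freely L (generated [set x false; x true]).
Proof.
move=> hx; apply: acts_freely_conj => c g /generated_pair[w0 <-].
have [[|l w] red <-] := reduced_word_at x w0; first by rewrite word_at_nil.
by move=> /(hx (l :: w) _ isT red)[]; rewrite trace_conj.
Qed.

Lemma generic_pair_free (L : groupClosed SL) (x : bool -> SL) :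
  (forall w A, w != [::] -> sorted compatible w -> A \in L ->
    trace (word_at x w) <> trace A) ->
  forall w, w != [::] -> sorted compatible w -> word_at x w <> 1%g.
Proof.
by move=> hx w w0 red w1; apply: (hx w 1%g w0 red); rewrite ?gpred1 ?w1.
Qed.

Lemma generic_pairs_dense (L : set SL) : countable L ->
  dense [set g : SL * SL | forall w A, w != [::] -> sorted compatible w -> L A ->
    trace (word_at (of_pair g) w) <> trace A].
Proof.
move=> cL U [g Ug] oU.
have [P [dP P0 lP]] : exists P : bool -> 'M[{poly C}]_2,
    [/\ forall b, \det (P b) = 1,
    forall b, map_mx (horner_eval 0) (P b) = val (of_pair g b) &
    forall b, leading_mx 4 (P b) (limit_mx C b)].
  by apply: SL2_pair_curve => b; exact: eqP (valP (of_pair g b)).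
have dPz z b : \det (map_mx (horner_eval z) (P b)) == 1.
  by rewrite det_map_mx dP rmorph1.
pose sl z b : SL := exist (fun A : 'M[C]_2 => \det A == 1) _ (dPz z b).
pose c (z : C) : SL * SL := (sl z false, sl z true).
have of_c z b : val (of_pair (c z) b) = map_mx (horner_eval z) (P b).
  by case: b.
have c0 : c 0 = g.
  case: g @c of_c P0 {Ug} => g1 g2 c of_c P0.
  by congr pair; apply/val_inj; [exact: P0 false | exact: P0 true].
have cont_c : continuous c.
  have cont b : continuous (fun z => of_pair (c z) b).
    apply: continuous_comp_initial; apply: continuous_mx => i j.
    have -> : (fun z => val (of_pair (c z) b) i j) = horner (P b i j).
      by apply/funext => z; rewrite of_c mxE.
    exact: continuous_horner_num.
  by move=> z; apply: (@cvg_pair _ _ _ (nbhs z)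
    (nbhs (of_pair (c z) false)) (nbhs (of_pair (c z) true)) _ _ _
    (fun z => of_pair (c z) false) (fun z => of_pair (c z) true)); exact: cont.
pose tr w : {poly C} := \tr (word_mx P w).
have trE z w : (tr w).[z] = trace (word_at (of_pair (c z)) w).
  rewrite /trace val_word_at -[LHS]/(horner_eval z (tr w)).
  rewrite -trace_map_mx map_word_mx.
  by congr (\tr (word_mx _ _)); apply/funext => b; rewrite of_c.
(* The bad parameters are the roots of countably many polynomials [tr w - trace A], none of them
   zero because [tr w] is nonconstant. *)
pose D := [set p : seq (bool * bool) * SL |
  [/\ p.1 != [::], sorted compatible p.1 & L p.2]].
pose bad := \bigcup_(p in D) [set z | root (tr p.1 - (trace p.2)%:P) z].
have cbad : countable bad.
  apply: bigcup_countable => [|[w A] [w0 red LA]].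
    apply: sub_countable (countableX (countableP [set: seq (bool * bool)]) cL).
    by apply: subset_card_le => p [].
  apply: countable_roots; rewrite subr_eq0.
  have sz : (1 < size (tr w))%N :=
    @mxtrace_word_nonconstant _ 4 P w isT dP lP w0 red.
  by apply: contraTneq sz => ->; rewrite -leqNgt size_polyC_leq1.
have nU : nbhs (c 0) U by rewrite c0; exact: open_nbhs_nbhs.
have /nbhs_ballP[e e0 eU] : nbhs (0 : C) (c @^-1` U) := cont_c 0 U nU.
have er : (complex.Re e)%:C%C = e by exact/RRe_real/gtr0_real.
(* Real parameters suffice, so a measure argument on the line finds one close to 0, where the curve
   is still in [U]. *)
have [t [t0 te tbad]] : exists t : R,
    [/\ 0 < t, t < complex.Re e & ~ bad (t%:C)%C].
  by apply: exists_real_avoiding cbad _; rewrite -ltcR er.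
exists (c (t%:C)%C); split.
  apply: eU; have t0' : 0 < (t%:C)%C by rewrite ltcR.
  have te' : (t%:C)%C < e by rewrite -er ltcR.
  by rewrite -ball_normE /ball_ /= sub0r normrN (gtr0_norm t0').
move=> w A w0 red LA eq; apply: tbad; exists (w, A); first by [].
by rewrite /= /root hornerD hornerN hornerC trE eq subrr.
Qed.

End SL2C.

(** * Free groups acting freely on the quotient by a cocompact lattice *)

Theorem proposition5p4 (R : realType) (Lambda : groupClosed (SL2C R))
    (hLambda : cocompact_lattice Lambda) :
  (exists Gamma : set (SL2C R),
    [/\ free_group Gamma, nonabelian Gamma & acts_freely Lambda Gamma]) /\
  (exists F : set (SL2C R * SL2C R),
    [/\ dense F, Gdelta F &
      forall gamma1 gamma2 : SL2C R, F (gamma1, gamma2) ->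
        free_group_of_rank 2 (generated [set gamma1; gamma2]) /\
        acts_freely Lambda (generated [set gamma1; gamma2])]).
Proof.
have [/countable_isolated_SL2C cL _] := hLambda.
pose F := [set g : SL2C R * SL2C R | forall w A,
  w != [::] -> sorted compatible w -> [set` Lambda] A ->
  trace (word_at (of_pair g) w) <> trace A].
have dF : dense F := generic_pairs_dense cL.
have FP g : F g -> forall w A,
    w != [::] -> sorted compatible w -> A \in Lambda ->
    trace (word_at (of_pair g) w) <> trace A by [].
split.
  (* The pair [(1, 1)] only shows that the whole space is nonempty; density then provides a point of
     [F]. *)
  have [|g [_ Fg]] := dF setT _ openT; first by exists (1%g, 1%g).
  exists (generated [set of_pair g false; of_pair g true]); split.
  - exists [set of_pair g false; of_pair g true].
    exact: free_pair_basis (generic_pair_free (FP _ Fg)).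
  - exact: free_pair_nonabelian (generic_pair_free (FP _ Fg)).
  - exact: generic_pair_acts_freely (FP _ Fg).
exists F; split=> //; last first.
  move=> g1 g2 Fg; split; last exact: generic_pair_acts_freely (FP _ Fg).
  exact: free_pair_rank (generic_pair_free (FP _ Fg)).
pose D := [set p : seq (bool * bool) * SL2C R |
  [/\ p.1 != [::], sorted compatible p.1 & [set` Lambda] p.2]].
have -> : F = \bigcap_(p in D)
    [set g | trace (word_at (of_pair g) p.1) <> trace p.2].
  rewrite eqEsubset; split=> g Fg; first by move=> [w A] [w0 red LA]; exact: Fg.
  by move=> w A w0 red LA; exact: (Fg (w, A)).
apply: Gdelta_bigcap => [|[w A] _].
  apply: sub_countable (countableX (countableP [set: seq (bool * bool)]) cL).
  by apply: subset_card_le => p [].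
(* Each condition is the preimage of the complement of a point under a continuous trace function. *)
apply: (@open_comp _ _
  (fun g : SL2C R * SL2C R => trace (word_at (of_pair g) w)) (~` [set trace A])).
  by move=> g _; exact: continuous_trace_word.
rewrite openC; apply/accessible_closed_set1/hausdorff_accessible.
exact: (@norm_hausdorff (Cplx R) (Cplx R)).
Qed.
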